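(* Let $c \geq 2$ and $n \geq 3$ be integers. Every collection of directed graphs $G_1, \ldots, G_c$ on a common set of $n$ vertices containing no rainbow $S_{1,1}$ satisfies \[\sum_{i=1}^c e(G_i) \leq \begin{cases} n^2-n & \text{if } c \leq 3,\\ c\left\lfloor\frac{n^2}{4}\right\rfloor & \text{if } c \geq 4. \end{cases} \] Moreover, these bounds are sharp: for all such $c,n$ there is a collection with no rainbow $S_{1,1}$ attaining equality.
   Context: Each $G_i$ is a directed graph without loops or multiple edges on the common vertex set $V$ (for distinct $u,v$, the edges $uv$ and $vu$ may both be present); $e(G_i)$ denotes the number of directed edges of $G_i$. Think of $G_i$ as the edges of color $i$. $S_{1,1}$ is the directed path with two edges $x\to y\to z$ on three distinct vertices. The collection contains a rainbow $S_{1,1}$ if there are distinct vertices $x,y,z\in V$ and distinct indices $i\neq j$ with $xy\in E(G_i)$ and $yz\in E(G_j)$. *)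

(* Defs.v *)
From mathcomp Require Export all_boot.

Set Implicit Arguments.
Unset Strict Implicit.
Unset Printing Implicit Defensive.

(* An edge relation is a set of ordered pairs, so multiple edges are excluded
   by construction, while uv and vu may both be present. *)
Record digraph (V : finType) := Digraph {
  edge :> rel V;
  edge_irrefl : irreflexive edge
}.

Definition num_edges (V : finType) (G : digraph V) : nat :=
  #|[set p : V * V | edge G p.1 p.2]|.

(* S_{1,1} is the directed path x -> y -> z; rainbow means that its two edges
   can be taken from two different members of the collection. *)
Definition has_rainbow_S11 (V : finType) (c : nat)
    (G : 'I_c -> digraph V) : Prop :=
  exists x y z : V, exists i j : 'I_c,
    [/\ [/\ x != y, y != z & x != z], i != j, edge (G i) x y
      & edge (G j) y z].

(* The truncated subtraction is the true one, as n <= n ^ 2. *)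
Definition S11_bound (c n : nat) : nat :=
  if c <= 3 then n ^ 2 - n else c * (n ^ 2 %/ 4).

(* Main.v *)
Require Import Defs.
From mathcomp Require Import all_boot.
From mathcomp Require Import zify.

Set Implicit Arguments.
Unset Strict Implicit.
Unset Printing Implicit Defensive.

(** Only the number [w x y] of colours of the arc [xy] matters: if [x <> z] and
    both [xy] and [yz] carry colours, then they carry one and the same single
    colour.  Hence the three arcs of a directed triangle carry at most
    [max c 3] colours, and averaging over all directed triangles gives the
    bound for [c <= 3], as well as for [n = 3].  If [c >= 4] and [n >= 4], then
    a vertex with both in- and out-arcs meets at most [c * (n / 2)] coloured
    arcs, so it can be deleted by induction; without such a vertex all arcs go
    from a set [A] to its complement, and there are at most
    [c * #|A| * (n - #|A|)] of them. *)

(** Only colour counts are kept, not the colours: two arcs of a path sharing their single colour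
    appear as two weights 1. Opposite arcs, the case [x = z], do not constrain each other. *)
Definition rainbow_free_weight (V : finType) (c : nat) (w : V -> V -> nat) :=
  [/\ forall x y, w x y <= c, forall x, w x x = 0
    & forall x y z, x != z ->
        [|| w x y == 0, w y z == 0 | (w x y == 1) && (w y z == 1)]].

(** Reversing all arcs lets a result about a heavy in-arc serve for a heavy out-arc. *)
Lemma rainbow_free_weight_rev (V : finType) (c : nat) (w : V -> V -> nat) :
  rainbow_free_weight c w -> rainbow_free_weight c (fun x y => w y x).
Proof.
case=> wc w0 wp; split=> // x y z xz.
by have := wp z y x; rewrite eq_sym => /(_ xz); lia.
Qed.

(** Any two arcs of the triangle form a path: either at most one of them is coloured, or each weighs
    at most 1. *)
Lemma triangle_weight (V : finType) (c : nat) (w : V -> V -> nat) x y z :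
  rainbow_free_weight c w -> [&& x != y, y != z & z != x] ->
  w x y + w y z + w z x <= maxn c 3.
Proof.
case=> wc _ wp /and3P[xy yz zx].
have := wp x y z; rewrite eq_sym => /(_ zx).
have := wp y z x; rewrite eq_sym => /(_ xy).
have := wp z x y; rewrite eq_sym => /(_ yz).
have := wc x y; have := wc y z; have := wc z x; lia.
Qed.

(** * Averaging over directed triangles *)

Section Triples.
Context (V : finType) (S : {set V}).

Lemma sum_rot3 (f : V -> V -> V -> nat) :
  \sum_(x in S) \sum_(y in S) \sum_(z in S) f y z x =
  \sum_(x in S) \sum_(y in S) \sum_(z in S) f x y z.
Proof.
rewrite exchange_big; apply: eq_bigr => x _.
by rewrite exchange_big.
Qed.

(** Each arc lies in [#|S| - 2] directed triangles, one for each third vertex. *)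
Lemma sum_triples (w : V -> V -> nat) : (forall x, w x x = 0) ->
  \sum_(x in S) \sum_(y in S) \sum_(z in S)
     [&& x != y, y != z & z != x] * w x y =
  (#|S| - 2) * \sum_(x in S) \sum_(y in S) w x y.
Proof.
move=> w0; rewrite big_distrr; apply: eq_bigr => x xS.
rewrite big_distrr; apply: eq_bigr => y yS.
rewrite -big_distrl /=; have [<-|xy] := eqVneq x y; first by rewrite w0 !muln0.
congr (_ * _); rewrite -big_mkcondr sum1dep_card /=.
have -> : #|S| - 2 = #|S :\ x :\ y|.
  by have := cardsD1 x S; have := cardsD1 y (S :\ x);
     rewrite in_setD1 xS yS eq_sym xy; lia.
by apply: eq_card => z; rewrite !inE andbC [y == z]eq_sym andbA.
Qed.

Lemma sum_neq : \sum_(x in S) \sum_(y in S) (x != y) = #|S| * (#|S| - 1).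
Proof.
rewrite -sum_nat_const; apply: eq_bigr => x xS.
rewrite -big_mkcondr sum1dep_card.
have -> : #|S| - 1 = #|S :\ x| by rewrite (cardsD1 x S) xS addKn.
by apply: eq_card => z; rewrite !inE andbC eq_sym.
Qed.

Lemma weight_le_triangles (c : nat) (w : V -> V -> nat) :
  rainbow_free_weight c w -> 2 < #|S| ->
  3 * (\sum_(x in S) \sum_(y in S) w x y) <= maxn c 3 * (#|S| * (#|S| - 1)).
Proof.
move=> rw S3; have [_ w0 _] := rw.
have S2 : 0 < #|S| - 2 by lia.
(* Multiplied by [#|S| - 2], both sides become sums over triangles, the right one with weight 1 on
   every arc. *)
rewrite -(leq_pmul2l S2) mulnCA -(sum_triples w0) mulnCA -sum_neq.
rewrite -sum_triples => [|x]; last by rewrite eqxx.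
pose D (x y z : V) := [&& x != y, y != z & z != x].
pose f x y z := D x y z * w x y.
(* Each triangle is counted from its three starting points, so its three arcs can be compared with
   [triangle_weight] term by term. *)
have -> : 3 * (\sum_(x in S) \sum_(y in S) \sum_(z in S) f x y z) =
  \sum_(x in S) \sum_(y in S) \sum_(z in S) (f x y z + f y z x + f z x y).
  have e1 := sum_rot3 f; have e2 := sum_rot3 (fun x y z => f z x y).
  rewrite /= in e2; rewrite !mulSn mul0n addn0 addnA -{2}e1 [in X in _ + X]e2.
  rewrite -!big_split; apply: eq_bigr => x _.
  rewrite -!big_split; apply: eq_bigr => y _.
  by rewrite -!big_split.
rewrite big_distrr; apply: leq_sum => x _; rewrite big_distrr.
apply: leq_sum => y _; rewrite big_distrr; apply: leq_sum => z _ /=.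
rewrite /f /D; case D1: [&& x != y, y != z & z != x].
  have := triangle_weight rw D1.
  by move: D1 => /and3P[-> -> ->] /=; lia.
have -> : [&& y != z, z != x & x != y] = false by lia.
by have -> : [&& z != x, x != y & y != z] = false by lia.
Qed.

End Triples.

(** * Degree of a vertex with both in- and out-arcs *)

Section Degree.
Context (V : finType) (c : nat) (S : {set V}).

Lemma degree_multiple_in (w : V -> V -> nat) x y :
  rainbow_free_weight c w -> y \in S -> x \in S -> 1 < w x y ->
  0 < \sum_(z in S) w y z ->
  \sum_(z in S) w z y + \sum_(z in S) w y z <= maxn (2 * c) (c + #|S| - 1).
Proof.
case=> wc w0 wp yS xS w2.
have xy : x != y by apply: contraTneq w2 => ->; rewrite w0.
(* The heavy arc [xy] forbids every out-arc of [y] except the one back to [x]. *)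
have -> : \sum_(z in S) w y z = w y x.
  rewrite (bigD1 x) //= big1 ?addn0 // => z /andP[_ zx].
  by have := wp x y z; rewrite eq_sym => /(_ zx); lia.
have ySx : y \in S :\ x by rewrite in_setD1 eq_sym xy.
move=> w1; rewrite (big_setD1 x) //= (big_setD1 y) //= w0 add0n.
have w_le1 z : z != x -> w z y <= 1 by move=> zx; have := wp z y x zx; lia.
have c1 := wc x y; have c2 := wc y x.
(* If [w y x] is 1, the other [#|S| - 2] in-arcs weigh at most 1 each, giving [c + #|S| - 1]; if it
   is larger, they vanish, giving [2 * c]. *)
have [w3|w3] := leqP (w y x) 1.
  have : \sum_(z in S :\ x :\ y) w z y <= #|S :\ x :\ y|.
    rewrite -sum1_card; apply: leq_sum => z /[!inE] /and3P[_ zx _].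
    exact: w_le1.
  have := cardsD1 x S; have := cardsD1 y (S :\ x); rewrite xS ySx; lia.
rewrite big1 => [|z /[!inE] /and3P[_ zx _]]; first by lia.
by have := wp z y x zx; lia.
Qed.

Lemma degree_inner (w : V -> V -> nat) y :
  rainbow_free_weight c w -> 3 < c -> 3 < #|S| -> y \in S ->
  0 < \sum_(z in S) w z y -> 0 < \sum_(z in S) w y z ->
  \sum_(z in S) w z y + \sum_(z in S) w y z <= c * (#|S| %/ 2).
Proof.
move=> rw c4 S4 yS Hi Ho.
have k2 : 2 <= #|S| %/ 2 by lia.
have k3 : #|S| <= 2 * (#|S| %/ 2) + 1 by lia.
have bound1 : maxn (2 * c) (c + #|S| - 1) <= c * (#|S| %/ 2) by nia.
have [/exists_inP[x xS w2]|/exists_inPn Ni] := boolP [exists x in S, 1 < w x y].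
  exact: leq_trans (degree_multiple_in rw yS xS w2 Ho) bound1.
have [/exists_inP[x xS w2]|/exists_inPn No] := boolP [exists x in S, 1 < w y x].
  rewrite addnC; apply: leq_trans bound1.
  exact: (degree_multiple_in (rainbow_free_weight_rev rw) yS xS w2 Hi).
have [_ w0 _] := rw.
have le1 (u : V -> nat) : u y = 0 -> (forall z, z \in S -> ~~ (1 < u z)) ->
    \sum_(z in S) u z <= #|S| - 1.
  move=> u0 u1; rewrite (big_setD1 y) //= u0 add0n.
  have -> : #|S| - 1 = #|S :\ y| by rewrite (cardsD1 y S) yS addKn.
  rewrite -sum1_card; apply: leq_sum => z /[!inE] /andP[_ zS].
  by have := u1 z zS; lia.
(* With no heavy arc at [y] the degree is at most [2 * (#|S| - 1)], hence at most
   [4 * (#|S| %/ 2)]. *)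
have := le1 _ (w0 y) Ni; have := le1 _ (w0 y) No; nia.
Qed.

End Degree.

(** * The bound for at least four colours *)

Lemma bipartite_weight (V : finType) (c : nat) (w : V -> V -> nat)
    (S : {set V}) :
  (forall x y, w x y <= c) ->
  (forall y, y \in S ->
     (\sum_(z in S) w z y == 0) || (\sum_(z in S) w y z == 0)) ->
  \sum_(x in S) \sum_(y in S) w x y <= c * (#|S| ^ 2 %/ 4).
Proof.
move=> wc inner.
(* [A] collects the vertices with out-arcs; they have no in-arcs, so every arc leaves [A]. *)
pose A := [set x in S | \sum_(z in S) w x z != 0].
have AS : A \subset S by apply/subsetP=> x; rewrite inE => /andP[].
have SDA : #|S :\: A| = #|S| - #|A| by rewrite cardsD (setIidPr AS).
have le_arcs : \sum_(x in S) \sum_(y in S) w x y <=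
    \sum_(x in A) \sum_(y in S :\: A) c.
  rewrite (big_setID A) /= (setIidPr AS) [X in _ + X]big1 ?addn0; last first.
    by move=> x; rewrite !inE => /andP[h xS]; move: h; rewrite xS /= negbK => /eqP.
  apply: leq_sum => x /[!inE] /andP[xS _].
  rewrite (big_setID A) /= (setIidPr AS) big1 ?add0n; first exact: leq_sum.
  move=> y /[!inE] /andP[yS /negPf yo].
  have := inner y yS; rewrite yo orbF sum_nat_eq0 => /forall_inP/(_ x xS).
  by move/eqP.
apply: leq_trans le_arcs _.
rewrite !sum_nat_const SDA mulnA mulnC leq_mul2l; apply/orP; right.
have := subset_leq_card AS; move: #|A| #|S| => a k ak.
by rewrite leq_divRL // -{2}(subnKC ak) mulnC nat_AGM2.
Qed.

Lemma weight_bound_ge4 (V : finType) (c : nat) (w : V -> V -> nat)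
    (S : {set V}) :
  rainbow_free_weight c w -> 3 < c -> 2 < #|S| ->
  \sum_(x in S) \sum_(y in S) w x y <= c * (#|S| ^ 2 %/ 4).
Proof.
move=> rw c4; move: {2}#|S| (erefl #|S|) => k.
elim: k S => [|k IH] S Sk S3; first by lia.
(* The induction starts at three vertices, where averaging gives [2 * c], and 2 is the floor of
   9/4. *)
have [S4|S4] := leqP #|S| 3.
  have S3' : #|S| = 3 by lia.
  have := weight_le_triangles rw S3.
  by rewrite S3' (_ : 3 ^ 2 %/ 4 = 2) //; lia.
have [wc w0 _] := rw.
have [/exists_inP[y yS /norP[]]|/exists_inPn H] := boolP [exists y in S,
  ~~ ((\sum_(z in S) w z y == 0) || (\sum_(z in S) w y z == 0))]; last first.
  by apply: bipartite_weight => // y yS; have := H y yS; rewrite negbK.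
rewrite -!lt0n => Hi Ho.
have Sy : #|S| = #|S :\ y|.+1 by rewrite (cardsD1 y S) yS.
have deg := degree_inner rw c4 S4 yS Hi Ho.
have IHy : \sum_(x in S :\ y) \sum_(z in S :\ y) w x z <=
    c * (#|S :\ y| ^ 2 %/ 4) by apply: IH; lia.
have -> : \sum_(x in S) \sum_(z in S) w x z =
    \sum_(x in S :\ y) \sum_(z in S :\ y) w x z +
    (\sum_(x in S) w x y + \sum_(z in S) w y z).
  rewrite (big_setD1 y) //= [\sum_(x in S) w x y](big_setD1 y) //= w0 add0n.
  rewrite addnC addnA; congr (_ + _); rewrite addnC -big_split.
  by apply: eq_bigr => x _; rewrite /= (big_setD1 y).
apply: leq_trans (leq_add IHy deg) _.
(* What remains is that the floors of [m^2/4] and [(m+1)/2] add up to at most that of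
   [(m+1)^2/4]. *)
rewrite -mulnDr leq_mul2l; apply/orP; right; rewrite Sy.
move: #|S :\ y| => m; rewrite -!mulnn.
nia.
Qed.

(** * From collections of digraphs to weights *)

Section Colours.
Context (V : finType) (c : nat) (G : 'I_c -> digraph V).

Definition colours (x y : V) := #|[set i | edge (G i) x y]|.

Lemma sum_num_edges :
  \sum_(i < c) num_edges (G i) = \sum_(x in V) \sum_(y in V) colours x y.
Proof.
pose E i (x y : V) : nat := edge (G i) x y.
have -> : \sum_(i < c) num_edges (G i) =
    \sum_(i < c) \sum_(x in V) \sum_(y in V) E i x y.
  apply: eq_bigr => i _; rewrite /num_edges -sum1dep_card big_mkcond.
  rewrite pair_big /=; apply: eq_bigr => -[x y] _ /=.
  by rewrite /E; case: edge.
rewrite exchange_big; apply: eq_bigr => x _.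
rewrite exchange_big; apply: eq_bigr => y _.
by rewrite /colours -sum1dep_card [RHS]big_mkcond; apply: eq_bigr => i _;
  rewrite /E; case: edge.
Qed.

Lemma colours_rainbow_free :
  ~ has_rainbow_S11 G -> rainbow_free_weight c colours.
Proof.
move=> noG; split=> [x y|x|x y z xz].
- by rewrite -[leqRHS]card_ord max_card.
- by apply/eqP; rewrite cards_eq0; apply/eqP/setP=> i; rewrite !inE edge_irrefl.
(* Each colour of [xy] equals each colour of [yz], so if both arcs are coloured, their colour sets
   are the same singleton. *)
have same i j : edge (G i) x y -> edge (G j) y z -> i = j.
  move=> ei ej; apply/eqP; apply: contraT => ij; case: noG.
  exists x, y, z, i, j; split=> //; split=> //.
  - by apply: contraTneq ei => ->; rewrite edge_irrefl.
  - by apply: contraTneq ej => ->; rewrite edge_irrefl.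
rewrite /colours !cards_eq0.
have [//|/set0Pn[i /[!inE] ei]] /= := eqVneq [set i | edge (G i) x y] set0.
have [//|/set0Pn[j /[!inE] ej]] /= := eqVneq [set i | edge (G i) y z] set0.
apply/andP; split; apply/cards1P.
  exists j; apply/setP=> k; rewrite !inE; apply/idP/eqP => [ek|->].
    exact: same ek ej.
  by rewrite -(same _ _ ei ej).
exists i; apply/setP=> k; rewrite !inE; apply/idP/eqP => [ek|->].
  by rewrite (same _ _ ei ek).
by rewrite (same _ _ ei ej).
Qed.

End Colours.

(** * Extremal collections *)

Definition empty_digraph (V : finType) : digraph V :=
  @Digraph V (fun _ _ => false) (fun _ => erefl).

Lemma neq_irrefl (V : finType) : irreflexive (fun x y : V => x != y).
Proof. by move=> x; rewrite eqxx. Qed.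

Definition complete_digraph (V : finType) : digraph V :=
  Digraph (@neq_irrefl V).

Lemma cut_irrefl (V : finType) (A : {set V}) :
  irreflexive (fun x y => (x \in A) && (y \notin A)).
Proof. by move=> x; rewrite andbN. Qed.

Definition cut_digraph (V : finType) (A : {set V}) : digraph V :=
  Digraph (@cut_irrefl V A).

Lemma num_edges_empty (V : finType) : num_edges (empty_digraph V) = 0.
Proof. by apply/eqP; rewrite cards_eq0; apply/eqP/setP=> p; rewrite !inE. Qed.

Lemma num_edges_complete (V : finType) :
  num_edges (complete_digraph V) = #|V| ^ 2 - #|V|.
Proof.
have := sum_neq [set: V]; rewrite cardsT mulnBr muln1 mulnn => <-.
rewrite /num_edges -sum1dep_card big_mkcond pair_big /=.
by apply: eq_big => [p|[x y] _ /=]; [rewrite !inE | case: (x != y)].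
Qed.

Lemma num_edges_cut (V : finType) (A : {set V}) :
  num_edges (cut_digraph A) = #|A| * (#|V| - #|A|).
Proof.
rewrite -(cardsC A) addKn -cardsX; apply: eq_card => -[x y].
by rewrite !inE.
Qed.

Theorem theorem5 (c n : nat) (hc : 2 <= c) (hn : 3 <= n)
    (V : finType) (hV : #|V| = n) :
  (forall G : 'I_c -> digraph V, ~ has_rainbow_S11 G ->
     \sum_(i < c) num_edges (G i) <= S11_bound c n)
  /\
  (exists G : 'I_c -> digraph V, ~ has_rainbow_S11 G /\
     \sum_(i < c) num_edges (G i) = S11_bound c n).
Proof.
rewrite /S11_bound; split.
  move=> G /colours_rainbow_free rw.
  have -> : \sum_(i < c) num_edges (G i) =
      \sum_(x in [set: V]) \sum_(y in [set: V]) colours G x y.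
    rewrite sum_num_edges; apply: eq_big => [x|x _]; first by rewrite !inE.
    by apply: eq_bigl => y; rewrite !inE.
  have hT : #|[set: V]| = n by rewrite cardsT.
  have [c3|c4] := leqP c 3; last first.
    by rewrite -hT; apply: weight_bound_ge4; rewrite ?hT.
  (* For [c <= 3] the maximum is 3 and cancels the factor 3 on the left. *)
  have := weight_le_triangles (S := [set: V]) rw; rewrite hT => /(_ hn).
  by rewrite (maxn_idPr c3) leq_pmul2l // mulnBr muln1 mulnn.
have [c3|c4] := leqP c 3.
  have c0 : 0 < c by lia.
  (* A single colour takes all arcs, so no path has two colours. *)
  exists (fun i : 'I_c => if i == Ordinal c0 then complete_digraph V
                          else empty_digraph V); split.
    case=> x [y [z [i [j [_ ij]]]]].
    by case: eqP => [ei|//]; case: eqP => [ej|//]; rewrite ei ej eqxx in ij.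
  rewrite (bigD1 (Ordinal c0)) //= num_edges_complete hV big1 ?addn0 //.
  by move=> i /negPf ->; exact: num_edges_empty.
(* Every colour takes all arcs of one balanced cut: no head of an arc is a tail, and the two sides
   have sizes [n %/ 2] and [n - n %/ 2], with product [n ^ 2 %/ 4]. *)
have hA : n %/ 2 <= #|[set: V]| by rewrite cardsT hV leq_div.
have /card_geqP[s [us ss _]] := hA.
exists (fun=> cut_digraph [set x in s]); split.
  case=> x [y [z [i [j [_ _ /andP[_ /negPf /= ny] /andP[/= yA _]]]]]].
  by rewrite yA in ny.
rewrite sum_nat_const card_ord num_edges_cut cardsE (card_uniqP us) ss hV.
congr (_ * _); rewrite -mulnn.
nia.
Qed.
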